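(* Let $\bar{\mathcal K}=\{\mathcal K_n\}_{n<\omega}$ be a sequence of classes of finite-dimensional normed spaces such that each $\mathcal K_n$ has the approximate Ramsey property (ARP). For every $n\in\mathbb N$, $X,Y\in\langle\bar{\mathcal K}\rangle_{=n}$, $r\in\mathbb N$ and every $\varepsilon>0$ there is $Z\in\langle\bar{\mathcal K}\rangle_{=n}$ such that every $r$-colouring of $\mathrm{Emb}(X,Z)$ has an $\varepsilon$-monochromatic set of the form $\rho\circ\mathrm{Emb}(X,Y)$ for some $\rho\in\mathrm{Emb}(Y,Z)$. Furthermore, if $\mathcal K_n=\mathcal K$ for each $n$ and $\mathcal K$ is closed under $\ell_\infty$-sums, then $Z$ can be chosen to be graded when $X$ and $Y$ are graded.
   Context: Conventions: $\omega=\{0,1,2,\dots\}$, $\mathbb N=\{1,2,\dots\}$; vector spaces are real; an integer $r$ is identified with $\{0,\dots,r-1\}$; classes of spaces are considered up to (multi-)isometry. A multi-seminormed space is a vector space $X$ with a sequence of seminorms $(\|\cdot\|_{X,n})_{n<\lambda_X}$, where $1\le\lambda_X\le\omega$ is its length. It is separated if for every $x\neq 0$ some $\|x\|_{X,n}\ne 0$, and graded if $\|x\|_{X,n}\le\|x\|_{X,m}$ for all $x$ and $n\le m<\lambda_X$. For a seminorm $\|\cdot\|$ on $X$, $X_{\|\cdot\|}$ is the normed space $X/\ker\|\cdot\|$ with $\|[x]\|:=\|x\|$. $\langle\bar{\mathcal K}\rangle_{=n}$ is the class of finite-dimensional separated multi-seminormed spaces $(X,(\|\cdot\|_j)_{j<n})$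 of length $n$ such that $X_{\|\cdot\|_j}\in\mathcal K_j$ for all $j<n$. $\mathrm{Emb}(X,Y)$ is the set of multi-isometric embeddings: injective linear $f:X\to Y$ (with $\lambda_X\le\lambda_Y$) such that $\|f(x)\|_{Y,m}=\|x\|_{X,m}$ for all $x\in X$, $m<\lambda_X$ (for normed spaces: linear isometric embeddings). For linear $h:X\to Y$ and $m<\lambda_X\le\lambda_Y$, $\|h\|_m:=\sup\{\|h(x)\|_{Y,m}:\|x\|_{X,m}\le1\}$. An $r$-colouring of a set $S$ is a map $S\to r$. Given $c:\mathrm{Emb}(X,Z)\to r$, a set $A\subseteq\mathrm{Emb}(X,Z)$ is $\varepsilon$-monochromatic if there is $i<r$ such that for every $\xi\in A$ there is $\eta\in\mathrm{Emb}(X,Z)$ with $c(\eta)=i$ and $\|\xi-\eta\|_m\le\varepsilon$ for all $m<\lambda_X$. A class $\mathcal C$ of finite-dimensional normed spaces has the ARP if for every $X,Y\in\mathcal C$, $r\in\mathbb N$ and $\varepsilon>0$ there is $Z\in\mathcal C$ such that for every $r$-colouring of $\mathrm{Emb}(X,Z)$ there is $\gamma\in\mathrm{Emb}(Y,Z)$ with $\gamma\circ\mathrm{Emb}(X,Y)$ $\varepsilon$-monochromatic. *)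

(* Defs.v *)
From HB Require Import structures.
From mathcomp Require Import all_boot all_order all_algebra.
From mathcomp Require Import ring_quotient generic_quotient.
From mathcomp Require Import all_classical all_reals all_analysis.
Import Order.TTheory GRing.Theory Num.Theory.
Import numFieldNormedType.Exports.

Set Implicit Arguments.
Unset Strict Implicit.
Unset Printing Implicit Defensive.

Local Open Scope classical_set_scope.
Local Open Scope ring_scope.

(* [seminorm 0 = 0] and non-negativity follow from the two axioms. *)
Record seminorm (R : realType) (V : lmodType R) := Seminorm {
  seminorm_fun :> V -> R;
  seminormD : forall x y : V,
    seminorm_fun (x + y) <= seminorm_fun x + seminorm_fun y;
  seminormZ : forall (a : R) (x : V),
    seminorm_fun (a *: x) = `|a| * seminorm_fun x }.

Section SeminormTheory.
Variables (R : realType) (V : lmodType R) (p : seminorm V).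

Lemma seminorm0 : p 0 = 0.
Proof. by rewrite -(scale0r 0) seminormZ normr0 mul0r. Qed.

Lemma seminormN x : p (- x) = p x.
Proof. by rewrite -scaleN1r seminormZ normrN1 mul1r. Qed.

Lemma seminorm_ge0 x : 0 <= p x.
Proof.
have := seminormD p x (- x); rewrite subrr seminorm0 seminormN -mulr2n.
by rewrite pmulrn_lge0.
Qed.

Lemma seminorm_sub0 x y : p (x - y) = 0 -> p x = p y.
Proof.
move=> h; apply/eqP; rewrite eq_le; apply/andP; split.
  by rewrite -[x](subrK y) (le_trans (seminormD p _ _))// h add0r.
rewrite -[y](subrK x) (le_trans (seminormD p _ _))//.
by rewrite -opprB seminormN h add0r.
Qed.

Definition seminorm_ker : {pred V} := fun x => p x == 0.

Lemma seminorm_ker_zmod_closed : zmod_closed seminorm_ker.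
Proof.
split; first by rewrite unfold_in /seminorm_ker seminorm0.
move=> x y; rewrite !unfold_in /seminorm_ker => /eqP px /eqP py.
rewrite eq_le seminorm_ge0 andbT (le_trans (seminormD p _ _))//.
by rewrite seminormN px py addr0.
Qed.

HB.instance Definition _ :=
  GRing.isZmodClosed.Build V seminorm_ker seminorm_ker_zmod_closed.

(* The normed space V / ker p; its additive structure is that of the library's
   quotient by a subgroup. *)
Definition seminorm_quot : Type := @Quotient.quot V seminorm_ker.

HB.instance Definition _ := GRing.Zmodule.on seminorm_quot.

Definition quot_class (x : V) : seminorm_quot :=
  (\pi_(@Quotient.quot V seminorm_ker) x)%qT.
Definition quot_repr (q : seminorm_quot) : V :=
  repr (q : @Quotient.quot V seminorm_ker).

Lemma quot_reprK q : quot_class (quot_repr q) = q.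
Proof. exact: reprK. Qed.

Lemma quot_classP x y : quot_class x = quot_class y <-> p (x - y) = 0.
Proof.
split=> [/eqP|/eqP h].
  by rewrite /quot_class -Quotient.idealrBE => /eqP.
by apply/eqP; rewrite /quot_class -Quotient.idealrBE.
Qed.

Lemma quot_classD x y : quot_class (x + y) = quot_class x + quot_class y.
Proof. exact: Quotient.pi_add. Qed.

Lemma quot_class0 : quot_class 0 = 0.
Proof. by apply: (addrI (quot_class 0)); rewrite -quot_classD !addr0. Qed.

Definition quot_scale (a : R) (q : seminorm_quot) : seminorm_quot :=
  quot_class (a *: quot_repr q).

Lemma quot_scaleE a x : quot_scale a (quot_class x) = quot_class (a *: x).
Proof.
apply/quot_classP; rewrite -scalerBr seminormZ.
have /quot_classP -> := quot_reprK (quot_class x).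
by rewrite mulr0.
Qed.

Lemma quot_scaleA a b q :
  quot_scale a (quot_scale b q) = quot_scale (a * b) q.
Proof. by rewrite -(quot_reprK q) !quot_scaleE scalerA. Qed.

Lemma quot_scale1 : left_id 1 quot_scale.
Proof. by move=> q; rewrite -(quot_reprK q) quot_scaleE scale1r. Qed.

Lemma quot_scaleDr : right_distributive quot_scale +%R.
Proof.
move=> a q q'; rewrite -(quot_reprK q) -(quot_reprK q').
by rewrite -quot_classD !quot_scaleE -quot_classD scalerDr.
Qed.

Lemma quot_scaleDl q : {morph quot_scale^~ q : a b / a + b}.
Proof.
by move=> a b; rewrite -(quot_reprK q) !quot_scaleE -quot_classD scalerDl.
Qed.

HB.instance Definition _ := GRing.Zmodule_isLmodule.Build R seminorm_quot
  quot_scaleA quot_scale1 quot_scaleDr quot_scaleDl.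

Definition quot_norm (q : seminorm_quot) : R := p (quot_repr q).

Lemma quot_normE x : quot_norm (quot_class x) = p x.
Proof. by apply/seminorm_sub0/quot_classP; rewrite quot_reprK. Qed.

Lemma quot_normD q q' : quot_norm (q + q') <= quot_norm q + quot_norm q'.
Proof.
rewrite -(quot_reprK q) -(quot_reprK q') -quot_classD !quot_normE.
exact: seminormD.
Qed.

Lemma quot_normZ (a : R) (q : seminorm_quot) :
  quot_norm (a *: q) = `|a| * quot_norm q.
Proof.
have -> : a *: q = quot_class (a *: quot_repr q) by [].
by rewrite quot_normE seminormZ.
Qed.

Lemma quot_norm_eq0 q : quot_norm q = 0 -> q = 0.
Proof.
rewrite -(quot_reprK q) quot_normE -quot_class0 => h.
by apply/quot_classP; rewrite subr0.
Qed.

HB.instance Definition _ := Lmodule_isNormed.Build R seminorm_quot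
  quot_normD quot_normZ quot_norm_eq0.

End SeminormTheory.

Record msspace (R : realType) (n : nat) := Msspace {
  ms_carrier :> lmodType R;
  msnorm : 'I_n -> seminorm ms_carrier }.

Definition findim (R : realType) (V : lmodType R) : Prop :=
  exists (d : nat) (b : 'I_d -> V),
    forall x : V, exists a : 'I_d -> R, x = \sum_(i < d) a i *: b i.

Definition separated (R : realType) (n : nat) (X : msspace R n) : Prop :=
  forall x : X, x != 0 -> exists j : 'I_n, msnorm X j x != 0.

Definition graded (R : realType) (n : nat) (X : msspace R n) : Prop :=
  forall (i j : 'I_n) (x : X), (i <= j)%N -> msnorm X i x <= msnorm X j x.

Definition norm_seminorm (R : realType) (N : normedModType R) : seminorm N :=
  @Seminorm R N (fun x => `|x|) (@ler_normD R N) (@normrZ R N).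

(* A normed space is a separated multi-seminormed space of length 1. *)
Definition ms_of_normed (R : realType) (N : normedModType R) : msspace R 1 :=
  @Msspace R 1 N (fun=> norm_seminorm N).

Record Emb (R : realType) (n : nat) (X Y : msspace R n) := MkEmb {
  emb_fun :> {linear X -> Y};
  emb_inj : injective emb_fun;
  emb_isom : forall (m : 'I_n) (x : X),
    msnorm Y m (emb_fun x) = msnorm X m x }.

Section EmbComp.
Variables (R : realType) (n : nat) (X Y Z : msspace R n).
Variables (g : Emb Y Z) (f : Emb X Y).

Let comp_fun : {linear X -> Z} := (emb_fun g \o emb_fun f)%FUN.

Lemma emb_comp_inj : injective comp_fun.
Proof. exact: inj_comp (@emb_inj _ _ _ _ g) (@emb_inj _ _ _ _ f). Qed.

Lemma emb_comp_isom (m : 'I_n) (x : X) :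
  msnorm Z m (comp_fun x) = msnorm X m x.
Proof. by rewrite /= !emb_isom. Qed.

Definition emb_comp : Emb X Z := MkEmb emb_comp_inj emb_comp_isom.

End EmbComp.

(* The supremum is taken in the extended reals. *)
Definition opnorm (R : realType) (n : nat) (X Y : msspace R n) (m : 'I_n)
    (h : X -> Y) : \bar R :=
  ereal_sup [set (msnorm Y m (h x))%:E | x in [set x | msnorm X m x <= 1]].

Definition eps_monochromatic (R : realType) (n : nat) (X Z : msspace R n)
    (r : nat) (c : Emb X Z -> 'I_r) (eps : R) (A : set (Emb X Z)) : Prop :=
  exists i : 'I_r, forall xi : Emb X Z, A xi ->
    exists eta : Emb X Z, c eta = i /\
      forall m : 'I_n, (opnorm m (fun x => xi x - eta x)%R <= eps%:E)%E.

(* Every r-colouring of Emb(X, Z) has an eps-monochromatic set of the form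
   rho o Emb(X, Y) with rho in Emb(Y, Z). *)
Definition ramsey_witness (R : realType) (n : nat) (X Y Z : msspace R n)
    (r : nat) (eps : R) : Prop :=
  forall c : Emb X Z -> 'I_r, exists rho : Emb Y Z,
    eps_monochromatic c eps [set emb_comp rho f | f in [set: Emb X Y]].

Definition isometric (R : realType) (N M : normedModType R) : Prop :=
  exists f : {linear N -> M}, bijective f /\ forall x : N, `|f x| = `|x|.

(* Classes of spaces are considered up to isometry, hence the closure. *)
Definition findim_normed_class (R : realType) (K : normedModType R -> Prop) :
    Prop :=
  (forall N, K N -> findim N) /\
  (forall N M, isometric N M -> K N -> K M).

Definition ARP (R : realType) (K : normedModType R -> Prop) : Prop :=
  forall X Y : normedModType R, K X -> K Y ->
  forall (r : nat) (eps : R), (0 < r)%N -> 0 < eps ->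
  exists Z : normedModType R, K Z /\
    ramsey_witness (ms_of_normed X) (ms_of_normed Y) (ms_of_normed Z) r eps.

(* The library's norm on a product is the maximum of the two norms. *)
Definition linf_sum_closed (R : realType) (K : normedModType R -> Prop) :
    Prop :=
  forall N M : normedModType R, K N -> K M -> K (N * M)%type.

Definition bracket_class (R : realType) (K : nat -> normedModType R -> Prop)
    (n : nat) (X : msspace R n) : Prop :=
  [/\ findim X, separated X &
      forall j : 'I_n, K j (seminorm_quot (msnorm X j))].

(* Main.v *)
Require Import Defs.
From HB Require Import structures.
From mathcomp Require Import all_boot all_order all_algebra.
From mathcomp Require Import lra.
From mathcomp Require Import all_classical all_reals all_analysis.
Import Order.TTheory GRing.Theory Num.Theory.
Import numFieldNormedType.Exports.

Local Open Scope ring_scope.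

Set Implicit Arguments.
Unset Strict Implicit.

(** Write $X_j$ for the quotient of $X$ by the kernel of its j-th seminorm.  A
    multi-isometric embedding of $X$ into $Y$ induces isometric embeddings
    $X_j \to Y_j$.  Conversely, if $Z$ is the product of normed spaces $Z_j$, the
    j-th seminorm of a point being the norm of its j-th coordinate, then any
    isometric embeddings $X_j \to Z_j$ glue to a multi-isometric embedding
    $X \to Z$, because a separated $X$ embeds into the product of its quotients.
    So the Ramsey property of $Z$ is a statement about colourings of a product of
    sets of embeddings between normed spaces ([ramsey_fam_space]), and it remains
    to prove a product version of the approximate Ramsey property
    ([product_ramsey]).

    This is an induction on the number of factors.  Take $Z_0$ from the ARP of the
    first class, for accuracy eps/2.  All spaces being finite-dimensional,
    $Emb(X_0, Z_0)$ is totally bounded: it splits into finitely many cells of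
    diameter at most eps/2 ([normed_emb_cells]).  A colouring of the whole product
    colours an embedding of the remaining factors by the finite list of its
    colours against one representative of each cell, and the induction hypothesis,
    with these lists as colours, makes the list essentially constant.  The constant
    list, read cell by cell, is a colouring of $Emb(X_0, Z_0)$, to which the choice
    of $Z_0$ applies; replacing an embedding by the representative of its cell
    costs the other eps/2.

    For graded spaces the same $Z_j$ are used, the j-th seminorm of the product
    being now the maximum of the norms of the coordinates $i \le j$.  This is
    graded by construction; it still extends the j-th seminorm of $X$ and $Y$
    since theirs are increasing in j; and its quotient by the kernel of the j-th
    seminorm is an l_infinity sum of the $Z_i$.  Both cases are treated at once by
    letting the j-th seminorm be a maximum over a list [D j] of coordinates. *)

(** * Total boundedness of finite-dimensional normed spaces *)

Lemma coord_le_norm (R : realType) n (v : 'rV[R]_n) i : `|v ord0 i| <= `|v|.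
Proof.
rewrite [X in _ <= X]/Num.norm/= mx_normrE.
exact: (le_bigmax 0 (fun ij : 'I_1 * 'I_n => `|v ij.1 ij.2|) (ord0, i)).
Qed.

(** All norms on a finite-dimensional space are equivalent.  A shortest spanning
    family is free, so the norm of a combination is continuous and positive on the
    compact unit sphere of the coefficient space; its minimum there gives C. *)
Lemma findim_coord_bound (R : realType) (N : normedModType R) :
  findim N -> exists (d : nat) (b : 'I_d -> N) (C : R), 0 <= C /\
    forall x : N, exists a : 'I_d -> R,
      x = \sum_(i < d) a i *: b i /\ forall i, `|a i| <= C * `|x|.
Proof.
case=> d [b bspan]; elim: d => [|d IHd] in b bspan *.
  exists 0, b, 0; split=> // x; have [a xE] := bspan x.
  by exists a; split=> // -[].
(* A nontrivial relation expresses one vector through the others, which then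
   already span. *)
have [[a [a0 [i ai0]]]|bfree] := pselect (exists a : 'I_d.+1 -> R,
    \sum_(i < d.+1) a i *: b i = 0 /\ exists i, a i != 0).
  apply: (IHd (fun k => b (lift i k))) => x; have [c ->] := bspan x.
  exists (fun k => c (lift i k) - c i / a i * a (lift i k)).
  have -> : \sum_(j < d.+1) c j *: b j =
      \sum_(j < d.+1) (c j - c i / a i * a j) *: b j.
    under [RHS]eq_bigr do rewrite scalerBl -scalerA.
    by rewrite big_split/= sumrN -scaler_sumr a0 scaler0 subr0.
  by rewrite (bigD1_ord i)//= mulfVK// subrr scale0r add0r.
pose f (v : 'rV[R]_d.+1) : R := `|\sum_(i < d.+1) v ord0 i *: b i|.
have f_cont : continuous f.
  have s_cont : continuous (fun v : 'rV[R]_d.+1 =>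
      \sum_(i < d.+1) v ord0 i *: b i).
    apply: (@continuous_big N _ +%R 0 xpredT) => [|i _ v].
      exact: add_continuous.
    apply: cvgZr_tmp; first exact: nbhs_filter.
    exact: coord_continuous.
  by move=> v; apply: cvg_norm; [exact: nbhs_filter | exact: s_cont].
pose S := [set v : 'rV[R]_d.+1 | `|v| = 1]%classic.
have S_compact : compact S.
  apply: bounded_closed_compact.
    by exists 1; split=> // M M1 v /= ->; exact: ltW.
  apply: (@preimage_closed _ _ (fun v : 'rV[R]_d.+1 => `|v|) [set 1]%classic).
    by move=> v _; exact: norm_continuous.
  exact: closed_eq.
have S0 : (S !=set0)%classic.
  have u0 : const_mx 1 != 0 :> 'rV[R]_d.+1.
    by apply/eqP => /rowP/(_ ord0)/eqP; rewrite !mxE oner_eq0.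
  exists (`|const_mx 1 : 'rV[R]_d.+1|^-1 *: const_mx 1).
  by rewrite /S/= normrZ normfV normr_id mulVf// normr_eq0.
have [c cS cmin] := compact_EVT_min S0 S_compact (continuous_subspaceT f_cont).
have fc0 : 0 < f c.
  rewrite normr_gt0; apply/eqP => c0; apply: bfree; exists (c ord0); split=> //.
  apply/not_existsP => ci0; move: cS; rewrite inE /S/=.
  suff -> : c = 0 by rewrite normr0 => /eqP; rewrite eq_sym oner_eq0.
  by apply/rowP => i; rewrite mxE; apply/eqP/negPn/negP/ci0.
exists d.+1, b, (f c)^-1; split=> [|x]; first by rewrite invr_ge0 ltW.
have [a xE] := bspan x; exists a; split=> // i.
pose v : 'rV[R]_d.+1 := \row_j a j.
have xf : `|x| = f v by rewrite xE /f; under [in RHS]eq_bigr do rewrite mxE.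
have le_av : `|a i| <= `|v|.
  have -> : a i = v ord0 i by rewrite mxE.
  exact: coord_le_norm.
rewrite (le_trans le_av)// ler_pdivlMl//.
have [->|v0] := eqVneq v 0; first by rewrite normr0 mulr0.
rewrite xf -ler_pdivlMr ?normr_gt0//.
have <- : f (`|v|^-1 *: v) = f v / `|v|.
  rewrite /f; under eq_bigr do rewrite mxE -scalerA.
  by rewrite -scaler_sumr normrZ normfV normr_id mulrC.
apply: cmin; rewrite inE /S/= normrZ normfV normr_id mulVf//.
by rewrite normr_eq0.
Qed.

(** The cells are the intervals of length delta, counted from -A. *)
Lemma real_cells (R : realType) (A delta : R) : 0 < delta ->
  exists (C : finType) (q : R -> C), forall s t : R,
    `|s| <= A -> `|t| <= A -> q s = q t -> `|s - t| <= delta.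
Proof.
move=> d0; pose u (s : R) := (s + A) / delta.
pose M := Num.trunc (u A).
exists 'I_M.+1, (fun s => inord (Num.trunc (u s))) => s t sA tA.
have tr w : `|w| <= A -> 0 <= u w /\ (Num.trunc (u w) < M.+1)%N.
  move=> wA; split.
    rewrite divr_ge0 ?(ltW d0)// -lerBlDr sub0r.
    by move: wA; rewrite ler_norml => /andP[].
  rewrite ltnS; apply: le_truncn.
  by rewrite ler_pM2r ?invr_gt0// lerD2r (le_trans (ler_norm _)).
have [us0 usM] := tr _ sA; have [ut0 utM] := tr _ tA.
move=> /(congr1 (@nat_of_ord _)); rewrite !inordK// => e.
have /andP[s1 s2] := truncn_itv us0; have /andP[t1 t2] := truncn_itv ut0.
rewrite -e in t1 t2.
have -> : s - t = (u s - u t) * delta.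
  by rewrite -mulrBl opprD addrACA subrr addr0 mulfVK// gt_eqF.
rewrite normrM (gtr0_norm d0) ler_piMl ?(ltW d0)// ler_norml.
move: s1 s2 t1 t2; rewrite -!natr1; lra.
Qed.

(** Balls are totally bounded.  Partitions into small cells are used in place of
    finite nets because they give colourings without choosing a nearest point. *)
Lemma ball_cells (R : realType) (N : normedModType R) (B delta : R) :
  findim N -> 0 < delta ->
  exists (C : finType) (q : N -> C), forall x y : N,
    `|x| <= B -> `|y| <= B -> q x = q y -> `|x - y| <= delta.
Proof.
move=> /findim_coord_bound[d [b [C [C0 coord]]]] d0.
have {coord}[a /all_and2[aE a_le]] := choice coord.
(* The summand 1 only serves to make the denominator positive. *)
pose E := 1 + \sum_(i < d) `|b i|.
have E0 : 0 < E by rewrite ltr_pwDl// sumr_ge0.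
have [Q [q qP]] := @real_cells R (C * B) (delta / E) (divr_gt0 d0 E0).
exists {ffun 'I_d -> Q}, (fun x => [ffun i => q (a x i)]) => x y xB yB /ffunP e.
have small i : `|a x i - a y i| <= delta / E.
  apply: qP; try by rewrite (le_trans (a_le _ _))// ler_wpM2l.
  by have := e i; rewrite !ffunE.
have -> : x - y = \sum_(i < d) (a x i - a y i) *: b i.
  by rewrite {1}(aE x) {1}(aE y) -sumrB; apply: eq_bigr => i _; rewrite scalerBl.
rewrite (le_trans (ler_norm_sum _ _ _))//.
apply: (@le_trans _ _ (\sum_(i < d) delta / E * `|b i|)).
  by apply: ler_sum => i _; rewrite normrZ ler_wpM2r.
rewrite -mulr_sumr -[X in _ <= X](divfK (lt0r_neq0 E0)) ler_wpM2l//.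
  by rewrite divr_ge0// ltW.
by rewrite /E lerDr.
Qed.

(** * Close embeddings and cells of the space of embeddings *)

(** Bounds the operator norms of f - g without suprema. *)
Definition emb_close (R : realType) (n : nat) (X Y : msspace R n) (eps : R)
    (f g : Emb X Y) : Prop :=
  forall (m : 'I_n) (x : X), msnorm X m x <= 1 -> msnorm Y m (f x - g x) <= eps.

Lemma opnorm_leP (R : realType) (n : nat) (X Y : msspace R n) (m : 'I_n)
    (h : X -> Y) (eps : R) :
  (opnorm m h <= eps%:E)%E <->
  forall x : X, msnorm X m x <= 1 -> msnorm Y m (h x) <= eps.
Proof.
split=> [h_le x x1|h_le].
  rewrite -lee_fin (le_trans _ h_le)//.
  by apply: ereal_sup_ubound; exists x.
by apply: ge_ereal_sup => _ [x /= x1 <-]; rewrite lee_fin h_le.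
Qed.

Lemma emb_close_trans (R : realType) (n : nat) (X Y : msspace R n) (d e : R)
    (f g h : Emb X Y) :
  emb_close d f g -> emb_close e g h -> emb_close (d + e) f h.
Proof.
move=> fg gh m x x1; rewrite -(subrKA (g x)).
by rewrite (le_trans (seminormD _ _ _))// lerD ?fg ?gh.
Qed.

Lemma ramsey_witnessP (R : realType) (n : nat) (X Y Z : msspace R n) (r : nat)
    (eps : R) :
  ramsey_witness X Y Z r eps <->
  forall c : Emb X Z -> 'I_r, exists (rho : Emb Y Z) (i : 'I_r),
    forall f : Emb X Y, exists eta : Emb X Z,
      c eta = i /\ emb_close eps (emb_comp rho f) eta.
Proof.
split=> H c; have [rho [i mono]] := H c; exists rho.
  exists i => f; have [|eta [ci close]] := mono (emb_comp rho f).
    by exists f.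
  by exists eta; split=> // m x x1; have /opnorm_leP := close m; apply.
exists i => _ [f _ <-]; have [eta [ci close]] := mono f.
by exists eta; split=> // m; apply/opnorm_leP => x; exact: close.
Qed.

Notation normed_emb N M := (Emb (ms_of_normed N) (ms_of_normed M)).

(** An embedding is isometric, so it maps a spanning family of X into a fixed ball
    of Z, and it is determined up to a small error by the cells of these images. *)
Lemma normed_emb_cells (R : realType) (X Z : normedModType R) (eps : R) :
  findim X -> findim Z -> 0 < eps ->
  exists (C : finType) (q : normed_emb X Z -> C), forall g h : normed_emb X Z,
    q g = q h -> emb_close eps g h.
Proof.
move=> /findim_coord_bound[d [b [C [C0 coord]]]] Zfin e0.
pose B := \sum_(i < d) `|b i|.
pose D := 1 + C * d%:R.
have D0 : 0 < D by rewrite ltr_pwDl// mulr_ge0.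
have [Q [q qP]] := ball_cells B Zfin (divr_gt0 e0 D0).
exists {ffun 'I_d -> Q}, (fun h => [ffun i => q (h (b i))]) => g h /ffunP gh.
move=> m x /= x1; have [a [xE a_le]] := coord x.
have ball (f : normed_emb X Z) i : `|f (b i)| <= B.
  rewrite [X in X <= _](emb_isom f m (b i))/= /B (bigD1 i)//= lerDl.
  exact: sumr_ge0.
have small i : `|g (b i) - h (b i)| <= eps / D.
  by apply: qP => //; have := gh i; rewrite !ffunE.
have -> : g x - h x = \sum_(i < d) a i *: (g (b i) - h (b i)).
  rewrite xE !linear_sum -big_split; apply: eq_bigr => i _ /=.
  by rewrite !linearZ scalerDr.
rewrite (le_trans (ler_norm_sum _ _ _))//.
apply: (@le_trans _ _ (\sum_(i < d) C * (eps / D))).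
  apply: ler_sum => i _; rewrite normrZ ler_pM//.
  by rewrite (le_trans (a_le i))// ler_piMr.
rewrite sumr_const card_ord -mulr_natl mulrA mulrC (mulrC d%:R).
rewrite -[X in _ <= X](divfK (lt0r_neq0 D0)) ler_wpM2l//.
  by rewrite divr_ge0// ltW.
by rewrite /D lerDr.
Qed.

(** * The Ramsey property of products of normed spaces *)

Lemma ARP_finType (R : realType) (K : normedModType R -> Prop)
    (X Y : normedModType R) (C : finType) (c0 : C) (eps : R) :
  ARP K -> K X -> K Y -> 0 < eps ->
  exists Z : normedModType R, K Z /\
    forall c : normed_emb X Z -> C, exists (rho : normed_emb Y Z) (i : C),
      forall f : normed_emb X Y, exists eta : normed_emb X Z,
        c eta = i /\ emb_close eps (emb_comp rho f) eta.
Proof.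
move=> KARP KX KY e0.
have C0 : (0 < #|C|)%N by apply/card_gt0P; exists c0.
have [Z [KZ /ramsey_witnessP Zram]] := KARP X Y KX KY _ _ C0 e0.
exists Z; split=> // c; have [rho [i mono]] := Zram (enum_rank \o c).
exists rho, (enum_val i) => f; have [eta [ci close]] := mono f.
by exists eta; split=> //; rewrite -ci /= enum_rankK.
Qed.

(** Stated with equations between functions so that the tail and the head can be
    substituted by the values of g, which avoids transports along equalities of
    indices.  It is used both for families of spaces and for families of
    embeddings. *)
Lemma dep_cons (n : nat) (E : 'I_n.+1 -> Type) (a : E ord0)
    (f : forall j : 'I_n, E (lift ord0 j)) :
  exists g : forall j, E j, g ord0 = a /\ (fun j => g (lift ord0 j)) = f.
Proof.
have mk j : exists y : E j, (forall e : ord0 = j, y = ecast i (E i) e a) /\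
    (forall k (e : lift ord0 k = j), y = ecast i (E i) e (f k)).
  case: (unliftP ord0 j) => [k ->|->].
    exists (f k); split=> [e|k' e].
      by have := neq_lift ord0 k; rewrite {1}e eqxx.
    by have kk := lift_inj e; subst k'; rewrite eq_axiomK.
  exists a; split=> [e|k e]; first by rewrite eq_axiomK.
  by have := neq_lift ord0 k; rewrite {1}e eqxx.
exists (fun j => sval (cid (mk j))); split.
  by have [+ _] := svalP (cid (mk ord0)) => /(_ erefl).
apply/functional_extensionality_dep => k.
by have [_ +] := svalP (cid (mk (lift ord0 k))) => /(_ _ erefl).
Qed.

(** Induction on n.  The number of colours for the remaining factors depends on the
    cells of the first one, so the first space is chosen first. *)
Lemma product_ramsey (R : realType) (n : nat)
    (K : 'I_n -> normedModType R -> Prop) (X Y : 'I_n -> normedModType R)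
    (C : finType) (c0 : C) (eps : R) :
  (forall j, findim_normed_class (K j)) -> (forall j, ARP (K j)) ->
  (forall j, K j (X j)) -> (forall j, K j (Y j)) -> 0 < eps ->
  exists Z : 'I_n -> normedModType R, (forall j, K j (Z j)) /\
    forall c : (forall j, normed_emb (X j) (Z j)) -> C,
    exists (rho : forall j, normed_emb (Y j) (Z j)) (i : C),
    forall f : (forall j, normed_emb (X j) (Y j)),
    exists eta : (forall j, normed_emb (X j) (Z j)),
      c eta = i /\ forall j, emb_close eps (emb_comp (rho j) (f j)) (eta j).
Proof.
move=> Kc KARP KX KY e0.
elim: n => [|n IHn] in K X Y C c0 Kc KARP KX KY *.
  exists X; split=> // c; pose trivial (E : 'I_0 -> Type) : forall j, E j :=
    fun j => False_rect _ (notF (ltn_ord j)).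
  exists (trivial _), (c (trivial _)) => f.
  by exists (trivial _); split=> // -[].
have e20 : 0 < eps / 2 by rewrite divr_gt0.
have [Z0 [KZ0 ram0]] := ARP_finType c0 (KARP ord0) (KX ord0) (KY ord0) e20.
have [T [q qP]] :=
  normed_emb_cells ((Kc ord0).1 _ (KX ord0)) ((Kc ord0).1 _ KZ0) e20.
have [Z' [KZ' ram']] := IHn (fun j => K (lift ord0 j)) (fun j => X (lift ord0 j))
  (fun j => Y (lift ord0 j)) {ffun T -> C} [ffun=> c0]
  (fun j => Kc (lift ord0 j)) (fun j => KARP (lift ord0 j))
  (fun j => KX (lift ord0 j)) (fun j => KY (lift ord0 j)).
have [Z [eZ0 eZ']] := dep_cons (E := fun=> normedModType R) Z0 Z'.
subst Z0 Z'.
exists Z; split=> [j|c].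
  by case: (unliftP ord0 j) => [k ->|->].
(* Cells may be empty, hence the option. *)
have /choice[rep repP] (t : T) : exists o : option (normed_emb (X ord0) (Z ord0)),
    forall h, q h = t -> exists2 h', o = Some h' & q h' = t.
  have [[h ht]|no] := pselect (exists h, q h = t).
    by exists (Some h) => _ _; exists h.
  by exists None => h ht; case: no; exists h.
pose join (h : normed_emb (X ord0) (Z ord0))
    (g : forall j, normed_emb (X (lift ord0 j)) (Z (lift ord0 j))) :=
  sval (cid (dep_cons (E := fun j => normed_emb (X j) (Z j)) h g)).
(* The colour of a tail g is the list of colours of (h, g), with h running over
   the cell representatives. *)
have [rho' [kappa mono']] := ram' (fun g => [ffun t =>
  if rep t is Some h then c (join h g) else c0]).
have [rho0 [i mono0]] := ram0 (fun h => kappa (q h)).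
have [rho [erho0 erho']] :=
  dep_cons (E := fun j => normed_emb (Y j) (Z j)) rho0 rho'.
subst rho0 rho'.
exists rho, i => f.
(* h may not have colour i against the tail; the representative h' of its cell
   does. *)
have [h [ki close0]] := mono0 (f ord0).
have [h' rep_h qh'] := repP _ _ (erefl (q h)).
have [g [kg close']] := mono' (fun j => f (lift ord0 j)).
have [eh' eg] : join h' g ord0 = h' /\ _ := svalP (cid (dep_cons _ _)).
exists (join h' g); split.
  by rewrite -ki -kg ffunE rep_h.
move=> j; case: (unliftP ord0 j) => [k ->|->].
  have -> : join h' g (lift ord0 k) = g k := congr1 (fun u => u k) eg.
  exact: close'.
rewrite eh' (splitr eps); apply: emb_close_trans close0 _.
exact: qP.
Qed.

(** * Seminormed quotients and induced embeddings *)

Definition linear_of (R : realType) (U V : lmodType R) (f : U -> V)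
    (lin_f : linear f) : {linear U -> V} :=
  HB.pack f (GRing.isLinear.Build R U V *:%R f lin_f).

Lemma quot_class_linear (R : realType) (V : lmodType R) (p : seminorm V) :
  linear (quot_class p).
Proof.
by move=> a x y; rewrite quot_classD; congr (_ + _); rewrite -quot_scaleE.
Qed.

(** First isomorphism theorem, used to recognize the quotients of products. *)
Lemma seminorm_quot_isometric (R : realType) (V : lmodType R) (p : seminorm V)
    (N : normedModType R) (T : {linear V -> N}) :
  (forall y, exists x, T x = y) -> (forall x, `|T x| = p x) ->
  isometric N (seminorm_quot p).
Proof.
move=> /choice[pre preK] Tp.
have class_eq x y : T x = T y -> quot_class p x = quot_class p y.
  by move=> e; apply/quot_classP; rewrite -Tp linearB e subrr normr0.
have lin : linear (fun y => quot_class p (pre y)).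
  move=> a y y'; rewrite -quot_class_linear; apply: class_eq.
  by rewrite linearP !preK.
exists (linear_of lin); split=> [|y]; last first.
  by rewrite -[LHS]/(quot_norm (quot_class p (pre y))) quot_normE -Tp preK.
exists (fun q => T (quot_repr q)) => [y|q] /=.
  rewrite -[RHS]preK; apply/eqP; rewrite -subr_eq0 -linearB -normr_eq0 Tp.
  by apply/eqP/quot_classP; rewrite quot_reprK.
by rewrite -[RHS]quot_reprK; apply: class_eq; rewrite preK.
Qed.

Lemma separated_emb (R : realType) (n : nat) (X Y : msspace R n) (f : X -> Y) :
  Defs.separated X -> linear f ->
  (forall m x, msnorm Y m (f x) = msnorm X m x) ->
  exists h : Emb X Y, forall x, h x = f x.
Proof.
move=> Xsep lin isom.
have inj : injective (linear_of lin).
  move=> x y /eqP; rewrite -subr_eq0 -linearB => /eqP e; apply/eqP.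
  rewrite -subr_eq0; apply/negPn/negP => /Xsep[j]; apply/negP/negPn.
  by rewrite -isom -[f _]/(linear_of lin _) e seminorm0.
by exists (MkEmb inj isom).
Qed.

Lemma ms_of_normed_separated (R : realType) (N : normedModType R) :
  Defs.separated (ms_of_normed N).
Proof. by move=> x x0; exists ord0; rewrite /= normr_eq0. Qed.

Lemma quotient_emb (R : realType) (n : nat) (X Y : msspace R n) (f : Emb X Y)
    (j : 'I_n) :
  exists h : normed_emb (seminorm_quot (msnorm X j)) (seminorm_quot (msnorm Y j)),
    forall x, h (quot_class _ x) = quot_class _ (f x).
Proof.
pose p := msnorm X j; pose q := msnorm Y j.
pose h0 (u : seminorm_quot p) := quot_class q (f (quot_repr u)).
have h0E x : h0 (quot_class p x) = quot_class q (f x).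
  apply/quot_classP; rewrite -linearB emb_isom.
  by apply/quot_classP; rewrite quot_reprK.
have lin : linear h0.
  move=> a u v; rewrite -(quot_reprK u) -(quot_reprK v).
  by rewrite -quot_class_linear !h0E linearP quot_class_linear.
have isom (m : 'I_1) (u : ms_of_normed (seminorm_quot p)) :
    msnorm (ms_of_normed (seminorm_quot q)) m (h0 u) =
    msnorm (ms_of_normed (seminorm_quot p)) m u.
  rewrite -(quot_reprK u) -[LHS]/(quot_norm (h0 _)) h0E quot_normE emb_isom.
  by rewrite -[RHS]/(quot_norm _) quot_normE.
have [h hE] := separated_emb (X := ms_of_normed _) (Y := ms_of_normed _)
  (@ms_of_normed_separated _ _) lin isom.
by exists h => x; rewrite hE h0E.
Qed.

(** * Products of normed spaces, seminormed by maxima of coordinates *)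

Lemma findim_finType (R : realType) (V : lmodType R) (I : finType) (b : I -> V) :
  (forall x, exists a : I -> R, x = \sum_(i : I) a i *: b i) -> findim V.
Proof.
move=> bspan; exists #|I|, (fun k => b (enum_val k)) => x.
have [a ->] := bspan x; exists (fun k => a (enum_val k)).
exact: (reindex _ (onW_bij _ (@enum_val_bij I))).
Qed.

(** A named copy of the dependent product, to carry the module structure. *)
Definition famprod (R : realType) (n : nat) (Z : 'I_n -> normedModType R) : Type :=
  forall i, Z i.

Section FamilyProduct.
Variables (R : realType) (n : nat) (Z : 'I_n -> normedModType R).
Implicit Types (x y z : famprod Z) (s : seq 'I_n).

HB.instance Definition _ := gen_eqMixin (famprod Z).
HB.instance Definition _ := gen_choiceMixin (famprod Z).

Let add x y : famprod Z := fun i => x i + y i.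
Let opp x : famprod Z := fun i => - x i.
Let zero : famprod Z := fun i => 0.
Let scale (a : R) x : famprod Z := fun i => a *: x i.

Let addA : associative add.
Proof. by move=> x y z; apply: functional_extensionality_dep => i; exact: addrA. Qed.
Let addC : commutative add.
Proof. by move=> x y; apply: functional_extensionality_dep => i; exact: addrC. Qed.
Let add0 : left_id zero add.
Proof. by move=> x; apply: functional_extensionality_dep => i; exact: add0r. Qed.
Let addN : left_inverse zero opp add.
Proof. by move=> x; apply: functional_extensionality_dep => i; exact: addNr. Qed.

HB.instance Definition _ := GRing.isZmodule.Build (famprod Z) addA addC add0 addN.

Let scaleA a b x : scale a (scale b x) = scale (a * b) x.
Proof. by apply: functional_extensionality_dep => i; exact: scalerA. Qed.
Let scale1 : left_id 1 scale.
Proof. by move=> x; apply: functional_extensionality_dep => i; exact: scale1r. Qed.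
Let scaleDr : right_distributive scale +%R.
Proof. by move=> a x y; apply: functional_extensionality_dep => i; exact: scalerDr. Qed.
Let scaleDl x : {morph scale^~ x : a b / a + b}.
Proof. by move=> a b; apply: functional_extensionality_dep => i; exact: scalerDl. Qed.

HB.instance Definition _ := GRing.Zmodule_isLmodule.Build R (famprod Z)
  scaleA scale1 scaleDr scaleDl.

Fact proj_linear i : linear (fun z => z i).
Proof. by []. Qed.

Definition fam_proj i : {linear famprod Z -> Z i} := linear_of (proj_linear i).

Definition fam_update z i (y : Z i) : famprod Z :=
  dfwith (T := fun i => Z i) z i y.

Lemma fam_update_eq z i (y : Z i) : fam_update z y i = y.
Proof. exact: dfwithin. Qed.

Lemma fam_update_neq z i (y : Z i) j : j != i -> fam_update z y j = z j.
Proof. by rewrite eq_sym; exact: dfwithout. Qed.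

Definition max_norm s z : R := \big[Num.max/0]_(i <- s) `|z i|.


Lemma max_norm_ge0 s z : 0 <= max_norm s z.
Proof. exact: bigmax_ge_id. Qed.

Lemma le_max_norm s z i : i \in s -> `|z i| <= max_norm s z.
Proof.
by move=> si; exact: (@le_bigmax_seq _ R _ s 0 i xpredT (fun i => `|z i|)).
Qed.

Lemma max_norm_le s z e : 0 <= e -> (forall i, i \in s -> `|z i| <= e) ->
  max_norm s z <= e.
Proof.
move=> e0 z_le; rewrite /max_norm big_seq.
by elim/big_ind: _ => // u v ue ve; rewrite ge_max ue.
Qed.

Fact max_normD s x y : max_norm s (x + y) <= max_norm s x + max_norm s y.
Proof.
apply: max_norm_le => [|i si]; first by rewrite addr_ge0 ?max_norm_ge0.
by rewrite (le_trans (ler_normD _ _))// lerD ?le_max_norm.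
Qed.

Fact max_normZ s a x : max_norm s (a *: x) = `|a| * max_norm s x.
Proof.
rewrite /max_norm; elim: s => [|i s IHs]; first by rewrite !big_nil mulr0.
by rewrite !big_cons IHs maxr_pMr// -normrZ.
Qed.

Definition max_seminorm s : seminorm (famprod Z) :=
  Seminorm (max_normD s) (max_normZ s).

Definition fam_space (D : 'I_n -> seq 'I_n) : msspace R n :=
  @Msspace R n (famprod Z) (fun j => max_seminorm (D j)).

Lemma fam_space_separated (D : 'I_n -> seq 'I_n) :
  (forall j, j \in D j) -> Defs.separated (fam_space D).
Proof.
move=> Dj z z0; apply/not_existsP => nz; case/eqP: z0.
apply: functional_extensionality_dep => j; apply/eqP.
have /negP/negPn/eqP z_j := nz j.
by rewrite -normr_le0 -z_j; exact: (@le_max_norm (D j) z).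
Qed.

Lemma famprod_findim : (forall j, findim (Z j)) -> findim (famprod Z).
Proof.
move=> /choice[d dP].
pose b j := sval (cid (dP j)).
have /= bP j := svalP (cid (dP j)).
refine (@findim_finType _ _ {j : 'I_n & 'I_(d j)}
  (fun t => fam_update 0 (b (tag t) (tagged t))) _) => z.
pose a j := sval (cid (bP j (z j))).
have aP j : z j = \sum_k a j k *: b j k := svalP (cid (bP j (z j))).
exists (fun t => a (tag t) (tagged t)).
apply: functional_extensionality_dep => i.
rewrite -[RHS]/(fam_proj i _) linear_sum/=.
rewrite -(@sig_big_dep _ _ _ _ _ xpredT (fun=> xpredT)
  (fun j k => (a j k *: fam_update 0 (b j k)) i))/=.
rewrite (bigD1 i)//= [X in _ + X]big1 ?addr0 => [|j ji].
  rewrite {1}aP; apply: eq_bigr => k _.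
  by rewrite -[RHS]/(_ *: (fam_update _ _ i)) fam_update_eq.
rewrite big1// => k _.
by rewrite -[LHS]/(_ *: (fam_update _ _ i)) fam_update_neq 1?eq_sym// scaler0.
Qed.

Lemma fam_quot_single (i : 'I_n) :
  isometric (Z i) (seminorm_quot (max_seminorm [:: i])).
Proof.
apply: (@seminorm_quot_isometric _ _ _ _ (fam_proj i)) => [y|z] /=.
  by exists (fam_update 0 y); rewrite fam_update_eq.
by rewrite /max_norm big_cons big_nil max_l.
Qed.

(** Coordinates outside s die in the quotient, which is therefore the l_infinity
    sum of the spaces in s, built by adding one summand at a time.  The list is
    nonempty because a class closed under binary sums need not contain the zero
    space. *)
Lemma fam_quot_sum (K : normedModType R -> Prop) s :
  findim_normed_class K -> linf_sum_closed K -> (forall i, K (Z i)) ->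
  s != [::] -> uniq s -> K (seminorm_quot (max_seminorm s)).
Proof.
move=> [_ Kisom] Ksum KZ; elim: s => [//|i s IHs] _ /andP[i_s s_uniq].
have [s0|s_neq0] := eqVneq s [::].
  by rewrite s0; apply: Kisom (KZ i); exact: fam_quot_single.
pose p := max_seminorm s.
have lin : linear (fun z => (z i, quot_class p z) : Z i * seminorm_quot p).
  by move=> a x y; congr pair; rewrite quot_class_linear.
apply: Kisom (Ksum _ _ (KZ i) (IHs s_neq0 s_uniq)).
apply: (@seminorm_quot_isometric _ _ _ _ (linear_of lin)) => [[y q]|z] /=.
  (* Changing coordinate i is invisible to p since i is not in s. *)
  exists (fam_update (quot_repr q) y); rewrite fam_update_eq; congr pair.
  rewrite -[RHS]quot_reprK; apply/quot_classP/le_anti.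
  rewrite seminorm_ge0 andbT; apply: max_norm_le => // j js.
  rewrite -[X in `|X|]/(fam_update (quot_repr q) y j - quot_repr q j).
  by rewrite fam_update_neq ?subrr ?normr0//; apply: contraNneq i_s => <-.
by rewrite /max_norm big_cons -[X in Num.max _ X](quot_normE p z).
Qed.

End FamilyProduct.

(** * Ramsey witnesses among seminormed products *)

(** Both the absence of a condition ([D j] is the single index j) and gradedness
    ([D j] consists of the indices up to j) are instances. *)
Definition monotone_along (R : realType) (n : nat) (D : 'I_n -> seq 'I_n)
    (X : msspace R n) : Prop :=
  forall (j i : 'I_n) (x : X), i \in D j -> msnorm X i x <= msnorm X j x.

(** The glued map is isometric for the j-th seminorm: by monotonicity the
    coordinates in [D j] contribute at most the j-th seminorm of x, and j itself,
    being in [D j], contributes exactly that. *)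
Lemma fam_emb (R : realType) (n : nat) (D : 'I_n -> seq 'I_n)
    (X : msspace R n) (Z : 'I_n -> normedModType R) :
  (forall j, j \in D j) -> Defs.separated X -> monotone_along D X ->
  forall g : (forall j, normed_emb (seminorm_quot (msnorm X j)) (Z j)),
  exists G : Emb X (fam_space Z D),
    forall x j, (G x : famprod Z) j = g j (quot_class (msnorm X j) x).
Proof.
move=> Dj Xsep Xmono g.
pose G0 x : famprod Z := fun j => g j (quot_class (msnorm X j) x).
have G0norm x j : `|G0 x j| = msnorm X j x.
  by rewrite [LHS](emb_isom (g j) ord0)/=; exact: quot_normE.
have lin : linear G0.
  move=> a x y; apply: functional_extensionality_dep => j.
  by rewrite /G0 quot_class_linear linearP.
have isom m x : msnorm (fam_space Z D) m (G0 x) = msnorm X m x.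
  apply/le_anti/andP; split.
    apply: max_norm_le => [|i iD]; first exact: seminorm_ge0.
    by rewrite G0norm Xmono.
  by rewrite -G0norm; exact: le_max_norm.
have [G GE] := separated_emb (Y := fam_space Z D) Xsep lin isom.
by exists G => x j; rewrite GE.
Qed.

(** Gluing transports the Ramsey property of the product of sets of embeddings to
    the seminormed product.  Errors do not grow: a vector in the unit ball of the
    j-th seminorm is, by monotonicity, in the unit balls of all those in [D j]. *)
Lemma ramsey_fam_space (R : realType) (n : nat) (D : 'I_n -> seq 'I_n)
    (K : nat -> normedModType R -> Prop) (X Y : msspace R n) (r : nat) (eps : R) :
  (forall j, findim_normed_class (K j)) -> (forall j, ARP (K j)) ->
  (forall j, j \in D j) -> monotone_along D X -> monotone_along D Y ->
  bracket_class K X -> bracket_class K Y -> (0 < r)%N -> 0 < eps ->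
  exists Z : 'I_n -> normedModType R,
    (forall j : 'I_n, K j (Z j)) /\ ramsey_witness X Y (fam_space Z D) r eps.
Proof.
move=> Kc KARP Dj Xmono Ymono [_ Xsep KX] [_ Ysep KY] r0 e0.
have [Z [KZ ram]] := product_ramsey (Ordinal r0) (fun j : 'I_n => Kc j)
  (fun j => KARP j) KX KY e0.
exists Z; split=> //; apply/ramsey_witnessP => c.
have /choice[embX embXE] := fam_emb (Z := Z) Dj Xsep Xmono.
have /choice[embY embYE] := fam_emb (Z := Z) Dj Ysep Ymono.
have [rho [i mono]] := ram (c \o embX).
exists (embY rho), i => f.
pose fq j := sval (cid (quotient_emb f j)).
have fqE j x : fq j (quot_class _ x) = quot_class _ (f x) :=
  svalP (cid (quotient_emb f j)) x.
have [eta [ci close]] := mono fq.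
exists (embX eta); split=> // m x x1.
apply: max_norm_le => [|k kD]; first exact: ltW.
have -> : (emb_comp (embY rho) f x - embX eta x : famprod Z) k =
    emb_comp (rho k) (fq k) (quot_class _ x) - eta k (quot_class _ x).
  rewrite -[LHS]/((embY rho (f x) : famprod Z) k - (embX eta x : famprod Z) k).
  by rewrite embXE embYE -fqE.
apply: (close k ord0); rewrite /= -[X in X <= _]/(quot_norm _) quot_normE.
by rewrite (le_trans _ x1)// Xmono.
Qed.

Theorem proposition4p7 (R : realType) (K : nat -> normedModType R -> Prop)
  (K_class : forall n : nat, findim_normed_class (K n))
  (K_ARP : forall n : nat, ARP (K n)) :
  (forall (n : nat) (X Y : msspace R n) (r : nat) (eps : R),
      (0 < n)%N -> bracket_class K X -> bracket_class K Y ->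
      (0 < r)%N -> 0 < eps ->
      exists Z : msspace R n, bracket_class K Z /\ ramsey_witness X Y Z r eps)
  /\
  (forall K0 : normedModType R -> Prop,
      (forall n : nat, K n = K0) -> linf_sum_closed K0 ->
      forall (n : nat) (X Y : msspace R n) (r : nat) (eps : R),
      (0 < n)%N -> bracket_class K X -> bracket_class K Y ->
      (0 < r)%N -> 0 < eps -> graded X -> graded Y ->
      exists Z : msspace R n,
        [/\ bracket_class K Z, graded Z & ramsey_witness X Y Z r eps]).
Proof.
split=> [n X Y r eps _ KX KY r0 e0|K0 KE Ksum n X Y r eps _ KX KY r0 e0 Xgr Ygr].
  pose D (j : 'I_n) := [:: j].
  have Dj j : j \in D j by rewrite inE.
  have mono (W : msspace R n) : monotone_along D W.
    by move=> j i x; rewrite inE => /eqP ->.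
  have [Z [KZ ram]] :=
    ramsey_fam_space K_class K_ARP Dj (mono X) (mono Y) KX KY r0 e0.
  exists (fam_space Z D); split=> //; split.
  - by apply: famprod_findim => j; exact: (K_class j).1.
  - exact: fam_space_separated.
  - by move=> j; apply: (K_class j).2 (KZ j); exact: fam_quot_single.
pose D (j : 'I_n) := [seq i : 'I_n <- enum 'I_n | (i <= j)%N].
have Dj j : j \in D j by rewrite mem_filter leqnn mem_enum.
have mono (W : msspace R n) : graded W -> monotone_along D W.
  by move=> Wgr j i x; rewrite mem_filter => /andP[ij _]; exact: Wgr.
have [Z [KZ ram]] :=
  ramsey_fam_space K_class K_ARP Dj (mono X Xgr) (mono Y Ygr) KX KY r0 e0.
exists (fam_space Z D); split=> //; first split.
- by apply: famprod_findim => j; exact: (K_class j).1.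
- exact: fam_space_separated.
- move=> j; have K0_class : findim_normed_class K0 by rewrite -(KE j).
  rewrite KE; apply: (fam_quot_sum K0_class Ksum) => [i||].
  + by rewrite -(KE i).
  + by apply/eqP => Dnil; have := Dj j; rewrite Dnil.
  + by rewrite filter_uniq// enum_uniq.
- move=> i j z ij; apply: max_norm_le => [|k]; first exact: seminorm_ge0.
  rewrite mem_filter => /andP[ki _]; apply: le_max_norm.
  by rewrite mem_filter (leq_trans ki ij) mem_enum.
Qed.
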